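(* Let $\tau$ be the usual product topology on $\mathbb R\times\mathbb R$. If $\mu$ is a $\mathcal C$-cross topology on $\mathbb R\times\mathbb R$ such that the family $\mathcal C$ contains a $\pi$-base for $\tau$, then $\mathrm{cov}(\mathcal M_\mu)=\mathrm{cov}(\mathcal M_{\mathbb R})$, where $\mathcal M_\mu$ is the $\sigma$-ideal of $\mu$-meager subsets of $\mathbb R\times\mathbb R$ and $\mathcal M_{\mathbb R}$ is the $\sigma$-ideal of meager subsets of $\mathbb R$ with its usual topology.
   Context: For $G\subseteq\mathbb R\times\mathbb R$, $G_x=\{y:(x,y)\in G\}$ and $G^y=\{x:(x,y)\in G\}$ denote the vertical and horizontal sections. $\mathcal C$-cross topology on $\mathbb R\times\mathbb R$: let $\mathcal C$ be a family of subsets of $\mathbb R\times\mathbb R$ which is closed under finite intersections and such that for each $G\in\mathcal C$ every non-empty vertical section $G_x$ and every non-empty horizontal section $G^y$ has non-empty interior in $\mathbb R$ (with its usual topology). The $\mathcal C$-cross topology is the topology on $\mathbb R\times\mathbb R$ generated by $\mathcal C$, for which $\mathcal C$ is a base. A $\pi$-base for a topology is a family of non-empty open sets such that every non-empty open set contains a member of the family. For a family $\mathcal F$ of subsets of a set $X$ with $X=\bigcup\mathcal F$, $\mathrm{cov}(\mathcal F)$ is the minimal cardinality of a subfamily $\mathcal W\subseteq\mathcal F$ with $\bigcup\mathcal W=X$. *)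

(* Defs.v *)
From HB Require Import structures.
From mathcomp Require Import all_boot all_order all_algebra.
From mathcomp Require Import all_classical all_reals all_analysis.
Import numFieldNormedType.Exports.

Set Implicit Arguments.
Unset Strict Implicit.
Unset Printing Implicit Defensive.

Local Open Scope classical_set_scope.
Local Open Scope card_scope.

Definition min_cover (X : Type) (F W : set (set X)) : Prop :=
  [/\ W `<=` F, \bigcup_(A in W) A = [set: X] &
      forall V : set (set X),
        V `<=` F -> \bigcup_(A in V) A = [set: X] -> W #<= V].

(* The cardinal cov(F) is represented by a subcover of F of minimal
   cardinality, so it is only meaningful up to [#=]. By [covP] such a subcover
   exists as soon as F covers X; the value is the junk set0 otherwise. *)
Definition cov (X : Type) (F : set (set X)) : set (set X) :=
  xget set0 (min_cover F).

Lemma card_le_min (U : pointedType) (S : set (set U)) : S !=set0 ->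
  exists2 W, S W & forall V, S V -> W #<= V.
Proof.
(* Take a maximal set E of choice functions on S all of whose evaluations are
   injective: some evaluation must be onto. *)
move=> S0.
pose P (E : set (set U -> U)) :=
  (forall f W, E f -> S W -> W (f W)) /\
  (forall f g W, E f -> E g -> S W -> f W = g W -> f = g).
have [|E [[Ein Einj] Emax]] := @Zorn_bigcup _ P.
  move=> F FP Ftot; split=> [f W [X FX Xf] SW|f g W [X FX Xf] [Y FY Yg] SW fg].
    exact: ((FP _ FX).1 f W Xf SW).
  have [XY|YX] := Ftot _ _ FX FY.
    exact: ((FP _ FY).2 f g W (XY _ Xf) Yg SW fg).
  exact: ((FP _ FX).2 f g W Xf (YX _ Yg) SW fg).
have [W SW WE] : exists2 W, S W & W `<=` (fun f => f W) @` E.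
  apply: contrapT => noW.
  have ex W : S W -> exists u, W u /\ forall f, E f -> f W <> u.
    move=> SW; apply: contrapT => nou; apply: noW; exists W => // u Wu.
    apply: contrapT => nf; apply: nou; exists u; split => // f Ef fWu.
    by apply: nf; exists f.
  pose g W := get [set u | W u /\ forall f, E f -> f W <> u].
  have gP W : S W -> W (g W) /\ forall f, E f -> f W <> g W.
    by move=> /ex; exact: getPex.
  apply: (Emax (E `|` [set g])).
    split; first by move=> f; left.
    move=> sub; have Eg : E g by apply: sub; right.
    by have [W SW] := S0; exact: ((gP _ SW).2 g Eg erefl).
  split=> [f W [Ef|->] SW|f h W [Ef|->] [Eh|->] SW fh] //.
  - exact: Ein Ef SW.
  - exact: (gP _ SW).1.
  - exact: Einj Ef Eh SW fh.
  - by have := (gP _ SW).2 f Ef fh.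
  - by have := (gP _ SW).2 h Eh (esym fh).
exists W => // V SV.
apply: (card_le_trans (subset_card_le WE)).
apply: (card_le_trans (card_image_le _ _)).
have /card_eqPle[_ EV] : (fun f => f V) @` E #= E.
  apply: inj_card_eq => f h /set_mem Ef /set_mem Eh fh.
  exact: Einj Ef Eh SV fh.
apply: (card_le_trans EV); apply: subset_card_le => _ [f Ef <-].
exact: Ein Ef SV.
Qed.

Lemma covP (X : Type) (F : set (set X)) :
  \bigcup_(A in F) A = [set: X] -> min_cover F (cov F).
Proof.
move=> FX; apply: xgetPex.
have [|W [WF WX] Wmin] := @card_le_min (set X)
  [set W | W `<=` F /\ \bigcup_(A in W) A = [set: X]]; first by exists F; split.
by exists W; split => // V VF VX; exact: Wmin.
Qed.

Definition nowhere_dense (T : topologicalType) (A : set T) : Prop :=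
  (closure A)° = set0.

Definition meager (T : topologicalType) (A : set T) : Prop :=
  exists2 F : (set T)^nat, (forall n, nowhere_dense (F n)) &
    A = \bigcup_n F n.

Definition pi_base (T : topologicalType) (P : set (set T)) : Prop :=
  (forall U, P U -> open U /\ U !=set0) /\
  (forall V : set T, open V -> V !=set0 -> exists2 U, P U & U `<=` V).

(* A copy of X carrying the coarsest topology in which every member of C is
   open; the alias keeps it apart from the topology X may already have. *)
Definition generated_space (X : choiceType) (C : set (set X)) : Type := X.

HB.instance Definition _ (X : choiceType) (C : set (set X)) :=
  Choice.on (generated_space C).
HB.instance Definition _ (X : choiceType) (C : set (set X)) :=
  isSubBaseTopological.Build (generated_space C) C id.

(* [basis] is taken in [generated_space C]; the interiors are taken in the
   usual topology of R. *)
Definition cross_family (R : realType) (C : set (set (R * R))) : Prop :=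
  [/\ setI_closed C,
      @basis (generated_space C) C,
      forall G (x : R), C G -> xsection G x !=set0 ->
        (xsection G x)° !=set0 &
      forall G (y : R), C G -> ysection G y !=set0 ->
        (ysection G y)° !=set0].

(* Main.v *)
Require Import Defs.
From mathcomp Require Import all_boot all_order all_algebra.
From mathcomp Require Import all_classical all_reals all_analysis.
Import numFieldNormedType.Exports.
Import Order.TTheory Num.Theory.
Local Open Scope classical_set_scope.
Local Open Scope card_scope.

(* By the Baire theorem every non-empty member of C is dense in some open
   rectangle; as C contains a pi-base, subsets of the plane that are nowhere
   dense in the usual topology are nowhere dense in the cross topology mu, so
   the strips A x R over a cover of R by meager sets A cover the plane by
   mu-meager sets. Conversely, as in the Kuratowski-Ulam theorem, the vertical
   sections of a mu-meager set B are meager outside a meager set M_B: if B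
   ranges over a cover of the plane, then either the sets M_B cover R, or the
   sections of the sets B at a point outside all M_B do. *)

Lemma nowhere_denseP (T : topologicalType) (A : set T) :
  nowhere_dense A <-> forall U, open U -> U !=set0 ->
    exists V, [/\ open V, V !=set0, V `<=` U & V `&` A = set0].
Proof.
split=> [ndA U oU [x Ux]|AP].
  exists (U `&` ~` closure A); split.
  - by apply: openI => //; apply: closed_openC; exact: closed_closure.
  - apply: contrapT => /nonemptyPn UA0.
    suff : (closure A)° x by rewrite ndA.
    have UA : U `<=` closure A.
      move=> y Uy; apply: contrapT => nAy.
      have : (U `&` ~` closure A) y by [].
      by rewrite UA0.
    by apply: (filterS UA); exact: open_nbhs_nbhs.
  - by move=> y [].
  - apply/seteqP; split=> // y [[_ nAy] Ay].
    by apply: nAy; exact: subset_closure.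
apply/nonemptyPn => -[x xA].
have [|V [oV [y Vy] VA VA0]] := AP _ (open_interior (closure A)); first by exists x.
have [z [Az Vz]] : A `&` V !=set0.
  by apply: (interior_subset (VA _ Vy)); exact: open_nbhs_nbhs.
have : (V `&` A) z by [].
by rewrite VA0.
Qed.

Lemma meager_bigcup (T : topologicalType) (F : (set T)^nat) :
  (forall n, meager (F n)) -> meager (\bigcup_n F n).
Proof.
move=> mF.
have /choice[G GP] n : exists G : (set T)^nat,
    (forall k, nowhere_dense (G k)) /\ F n = \bigcup_k G k.
  by have [G ndG ->] := mF n; exists G.
(* The double sequence is listed along codes of pairs; codes of no pair give [set0], which is
   nowhere dense. *)
exists (fun m => if unpickle m is Some (n, k) then G n k else set0) => [m|].
  case: (unpickle m) => [[n k]|]; first exact: (GP n).1.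
  by rewrite /nowhere_dense closure0 interior0.
apply/seteqP; split=> [x [n _]|x [m _]].
  by rewrite (GP n).2 => -[k _ Gx]; exists (pickle (n, k)); rewrite ?pickleK.
case: (unpickle m) => // -[n k] Gx.
by exists n => //; rewrite (GP n).2; exists k.
Qed.

Lemma open_not_meager (R : realType) (F : (set R)^nat) (U : set R) :
  (forall n, nowhere_dense (F n)) -> open U -> U !=set0 ->
  ~ U `<=` \bigcup_n F n.
Proof.
move=> ndF oU U0 UF.
have /(_ U U0 oU)[x [Ux nFx]] : dense (\bigcap_n (~` closure (F n))).
  apply: Baire => n; split.
    by apply: closed_openC; exact: closed_closure.
  move=> V V0 oV; have /nowhere_denseP/(_ _ oV V0)[W [oW [x Wx] WV WF]] := ndF n.
  exists x; split; first exact: WV.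
  move=> /(_ W); case; first exact: open_nbhs_nbhs.
  move=> y [Fy Wy]; have : (W `&` F n) y by [].
  by rewrite WF.
have [n _ Fx] := UF _ Ux.
by apply: (nFx n) => //; exact: subset_closure.
Qed.

(** Countability is the point: a condition on all open sets of the line becomes one condition per
    [K n], so that Baire category applies. *)
Lemma countable_pi_base (R : realType) :
  exists K : (set R)^nat, pi_base (range K).
Proof.
(* The default [setT] keeps every [K n] open and non-empty, also for codes of no pair and for radii
   that are not positive. *)
pose K n : set R := if (unpickle n : option (rat * rat)) is Some (c, r)
  then if (0 < r)%R then ball (@ratr R c) (ratr r) else setT else setT.
exists K; split=> [_ [n _ <-]|V oV [x Vx]].
  rewrite /K; case: (unpickle n) => [[c r]|]; last first.
    by split; [exact: openT|exists point].
  case: ifPn => [r0|_]; last by split; [exact: openT|exists point].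
  split; first exact: ball_open.
  by exists (ratr c); apply: ballxx; rewrite ltr0q.
have [|c [r [/set_mem xB BV]]] := open_subball_rat oV (x := x); first exact/mem_set.
exists (ball (@ratr R c) (ratr r)) => //; exists (pickle (c, r)) => //.
rewrite /K pickleK ifT//.
(* The radius is positive because it strictly exceeds the distance from [x] to the centre. *)
have := le_lt_trans (normr_ge0 _) xB.
by rewrite ltr0q.
Qed.

Lemma open_setX (T U : topologicalType) (A : set T) (B : set U) :
  open A -> open B -> open (A `*` B).
Proof.
rewrite !openE => oA oB [x y] [/= Ax By].
by exists (A, B) => //; split; [exact: oA|exact: oB].
Qed.

Section cross_topology.
Context {R : realType} {C : set (set (R * R))} (hC : cross_family C).
Context {P : set (set (R * R))} (PC : P `<=` C) (hP : pi_base P).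
Local Notation mu := (generated_space C).

Lemma cross_member_open G : C G -> open (G : set mu).
Proof. by have [_ [+ _] _ _] := hC; exact. Qed.

Lemma cross_base (U : set mu) : open U -> U !=set0 ->
  exists G, [/\ C G, G !=set0 & G `<=` U].
Proof.
have [_ [_ Cbase] _ _] := hC.
move=> oU [x Ux]; have [|G [CG Gx] GU] := Cbase x U.
  exact: open_nbhs_nbhs.
by exists G; split => //; exists x.
Qed.

(* By the Baire property, some basic interval K lies in the vertical sections
   of G at a set of points x that is dense in some interval. *)
Lemma cross_closure_interior G : C G -> G !=set0 -> (closure G)° !=set0.
Proof.
move=> CG [[a b] Gab]; have [_ _ Cx Cy] := hC.
have [K [Kopen Kpi]] := countable_pi_base R.
pose D n := [set x | K n `<=` xsection G x].
have I0 : (ysection G b)° !=set0 by apply: Cy => //; exists a; apply/ysectionP.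
have ID : (ysection G b)° `<=` \bigcup_n D n.
  move=> x /interior_subset/ysectionP Gxb.
  have [||_ [n _ <-] KG] := Kpi (xsection G x)°.
  - exact: open_interior.
  - by apply: Cx => //; exists b; apply/xsectionP.
  - by exists n => // y /KG /interior_subset.
have [n /eqP/set0P[x Dx]] : exists n, (closure (D n))° <> set0.
  apply: contrapT => /forallNP ndD; apply: open_not_meager ID => //.
    by move=> n; apply: contrapT; exact: ndD.
  exact: open_interior.
have [oK [y Ky]] := Kopen (K n) (ex_intro2 _ _ n I erefl).
exists (x, y), ((closure (D n))°, K n) => /=.
  split; first by apply: open_nbhs_nbhs; split => //; exact: open_interior.
  exact: open_nbhs_nbhs.
(* Near [u] there is some [w] in [D n]; since [K n] lies in the section of [G] at [w], the point
   [(w, v)] belongs to [G]. *)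
move=> [u v] [/= /interior_subset Du Kv] W [[J L] [/= Ju Lv] JLW].
have [w [Dw Jw]] := Du _ Ju.
exists (w, v); split; first by apply/xsectionP; exact: Dw.
by apply: JLW; split => //=; exact: nbhs_singleton.
Qed.

Lemma nowhere_dense_cross (A : set (R * R)) :
  nowhere_dense A -> nowhere_dense (A : set mu).
Proof.
move=> /nowhere_denseP ndA; apply/nowhere_denseP => U oU U0.
have [G [CG G0 GU]] := cross_base U oU U0.
have [V [oV V0 VG VA]] :=
  ndA _ (open_interior (closure G)) (cross_closure_interior G CG G0).
have [Q PQ QV] := hP.2 V oV V0; have [oQ [q Qq]] := hP.1 Q PQ.
(* Intersecting with [Q] stays in [C], hence is mu-open, and avoids [A]; it is non-empty because [Q]
   lies in the interior of [closure G]. *)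
exists (G `&` Q); split.
- by apply: cross_member_open; have [CI _ _ _] := hC; apply: CI => //; exact: PC.
- by apply: (interior_subset (VG _ (QV _ Qq))); exact: open_nbhs_nbhs.
- by move=> z [/GU].
- by rewrite -subset0 -VA => z [[_ /QV]].
Qed.

Lemma meager_cross_strip (A : set R) :
  meager A -> meager (A `*` setT : set mu).
Proof.
move=> [F ndF ->]; exists (fun n => F n `*` setT); last first.
  by apply/seteqP; split=> [[x y] [[n _ Fx] _]|[x y] [n _ [Fx _]]];
    [exists n|split => //; exists n].
move=> n; apply/nowhere_dense_cross/nowhere_denseP => U oU [[x y] Uxy].
have [[J L] [/= Jx Ly] JLU] : nbhs (x, y) U by exact: open_nbhs_nbhs.
have /nowhere_denseP/(_ J°)[||V [oV [v Vv] VJ VF]] := ndF n.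
- exact: open_interior.
- by exists x.
exists (V `*` L°); split.
- by apply: open_setX => //; exact: open_interior.
- by exists (v, y).
- move=> [u w] [/= /VJ/interior_subset Ju /interior_subset Lw].
  exact: (JLU (u, w)).
- rewrite -subset0 => -[u w] [[/= Vu _] [/= Fu _]].
  have : (V `&` F n) u by [].
  by rewrite VF.
Qed.

(** A section is nowhere dense once it misses a non-empty open part of each [K n]. These are
    countably many conditions [E n], and each fails only on a nowhere dense set of points. *)
Lemma nowhere_dense_cross_xsection (N : set mu) : nowhere_dense N ->
  exists2 M : set R, meager M &
    forall x, ~ M x -> nowhere_dense (xsection N x).
Proof.
move=> /nowhere_denseP ndN; have [_ _ Cx Cy] := hC.
have [K [Kopen Kpi]] := countable_pi_base R.
pose E n := [set x | exists V : set R,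
  [/\ open V, V !=set0, V `<=` K n & V `&` xsection N x = set0]].
exists (\bigcup_n ~` E n).
  exists (fun n => ~` E n) => // n; apply/nowhere_denseP => U oU [x Ux].
  have [oK [y Ky]] := Kopen (K n) (ex_intro2 _ _ n I erefl).
  (* The rectangle itself need not be mu-open; a member of the pi-base inside it is. *)
  have [||Q PQ QUK] := hP.2 (U `*` K n); [exact: open_setX|by exists (x, y)|].
  have [||W [oW W0 WQ WN]] := ndN Q.
  - exact/cross_member_open/PC.
  - exact: (hP.1 Q PQ).2.
  have [G [CG [[a b] Gab] GW]] := cross_base W oW W0.
  (* For every [u] in this set the vertical section of [G] at [u] contains [b], so it has non-empty
     interior; this interior lies in [K n] and misses [N], whence [u] is in [E n]. *)
  exists (ysection G b)°; split.
  - exact: open_interior.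
  - by apply: Cy => //; exists a; apply/ysectionP.
  - by move=> u /interior_subset/ysectionP/GW/WQ/QUK[].
  - rewrite -subset0 => u [/interior_subset/ysectionP Gub]; apply.
    exists (xsection G u)°; split.
    + exact: open_interior.
    + by apply: Cx => //; exists b; apply/xsectionP.
    + by move=> v /interior_subset/xsectionP/GW/WQ/QUK[].
    + rewrite -subset0 => v [/interior_subset/xsectionP/GW Wuv /xsectionP Nuv].
      have : (W `&` N) (u, v) by [].
      by rewrite WN.
move=> x nMx; apply/nowhere_denseP => U oU U0.
have [_ [n _ <-] KU] := Kpi U oU U0.
have [V [oV V0 VK VN]] : E n x by apply: contrapT => nE; apply: nMx; exists n.
by exists V; split => // v /VK/KU.
Qed.

Lemma meager_cross_xsection (B : set mu) : meager B ->
  exists2 M : set R, meager M & forall x, ~ M x -> meager (xsection B x).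
Proof.
move=> [F ndF ->].
have /choice[M MP] n : exists M : set R, meager M /\
    forall x, ~ M x -> nowhere_dense (xsection (F n) x).
  by have [M mM MF] := nowhere_dense_cross_xsection (F n) (ndF n); exists M.
exists (\bigcup_n M n) => [|x nMx].
  by apply: meager_bigcup => n; exact: (MP n).1.
exists (fun n => xsection (F n) x); last exact: xsection_bigcup.
by move=> n; apply: (MP n).2 => Mx; apply: nMx; exists n.
Qed.

End cross_topology.

Lemma meager_covers (R : realType) : \bigcup_(A in @meager R) A = setT.
Proof.
apply/seteqP; split=> // x _; exists [set x] => //; exists (fun=> [set x]).
  by move=> _; rewrite /nowhere_dense -(closure_id _).1 ?interior_set1//.
by rewrite bigcup_const.
Qed.

Theorem theorem8 (R : realType) (C : set (set (R * R)%type))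
  (hC : cross_family C)
  (hpi : exists2 P : set (set (R * R)%type), P `<=` C & pi_base P) :
  cov (@meager (generated_space C)) #= cov (@meager R).
Proof.
have [P PC hP] := hpi.
have [WR WRcov WRmin] := covP (meager_covers R).
have strips : (fun A => A `*` setT) @` cov (@meager R) `<=`
    @meager (generated_space C).
  by move=> _ [A /WR mA <-]; exact: (meager_cross_strip hC PC hP).
have stripsT : \bigcup_(B in (fun A => A `*` setT) @` cov (@meager R)) B =
    [set: generated_space C].
  rewrite bigcup_image; apply/seteqP; split=> // -[x y] _.
  have [A WA Ax] : (\bigcup_(A in cov (@meager R)) A) x by rewrite WRcov.
  by exists A.
(* The strips also show that the mu-meager sets cover the plane, so that [cov] is not the junk value
   here. *)
have muT : \bigcup_(B in @meager (generated_space C)) B = setT.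
  apply/seteqP; split=> // z _.
  have [B WB Bz] : (\bigcup_(B in (fun A => A `*` setT) @` cov (@meager R)) B) z.
    by rewrite stripsT.
  by exists B => //; exact: strips.
have [Wmu Wmucov Wmumin] := covP muT.
rewrite card_eq_le; apply/andP; split.
  exact: card_le_trans (Wmumin _ strips stripsT) (card_image_le _ _).
have /choice[M MP] (B : set (generated_space C)) : exists M : set R,
    meager B -> meager M /\ forall x, ~ M x -> meager (xsection B x).
  have [mB|nmB] := pselect (meager B); last by exists set0.
  by have [M mM MB] := meager_cross_xsection hC PC hP B mB; exists M.
pose W := cov (@meager (generated_space C)).
(* In both cases the resulting cover of the line is an image of [W], hence no larger than [W]. *)
have [[x nMx]|nx] := pselect (exists x, forall B, W B -> ~ M B x).
  apply: card_le_trans (WRmin ((xsection (T2:=R))^~ x @` W) _ _) (card_image_le _ _).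
  - by move=> _ [B WB <-]; apply: (MP B (Wmu _ WB)).2; exact: nMx.
  - rewrite bigcup_image; apply/seteqP; split=> // y _.
    have [B WB Bxy] : (\bigcup_(B in W) B) (x, y) by rewrite Wmucov.
    by exists B => //; exact/xsectionP.
apply: card_le_trans (WRmin (M @` W) _ _) (card_image_le _ _).
- by move=> _ [B /Wmu mB <-]; exact: (MP B mB).1.
- rewrite bigcup_image; apply/seteqP; split=> // x _.
  apply: contrapT => nMx; apply: nx; exists x => B WB MBx.
  by apply: nMx; exists B.
Qed.
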